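(* Let $m>n$, let $A\in\mathbb{R}^{m\times n}$ have full column rank with every column of unit Euclidean norm, let $b\in\mathbb{R}^m$, and let $x_\star=A^{\dagger}b$ be the unique minimizer of $\|b-Ax\|^2$ over $x\in\mathbb{R}^n$. The iteration sequence $\{x_k\}_{k=0}^\infty$ generated by the greedy double subspaces coordinate descent (GDSCD) method (defined in the context), starting from any initial guess $x_0\in\mathbb{R}^n$, converges linearly to the unique least-squares solution $x_\star$ and satisfies $$\|x_\star-x_1\|_{A^TA}^2\le\left(1-\sigma(A^T,\infty)^2\right)\|x_\star-x_0\|_{A^TA}^2$$ and $$\|x_\star-x_{k+1}\|_{A^TA}^2\le\left(1-\frac{1}{1-\widetilde\mu_k^2}\,\sigma(A^T,\infty)^2\right)\|x_\star-x_k\|_{A^TA}^2,\qquad k=1,2,\dots,$$ where $\widetilde\mu_k=\langle A_{(j_{k_1})},A_{(j_{k_2})}\rangle$ for the two column indices $j_{k_1},j_{k_2}$ selected by the method at step $k$, and $\sigma(A^T,\infty)$ is the Hoffman-like constant defined in the context.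
   Context: Notation: $\|\cdot\|$ is the Euclidean norm, $\|\cdot\|_\infty$ the maximum norm of a vector, and $\langle\cdot,\cdot\rangle$ the standard Euclidean inner product. $A_{(j)}$ is the $j$th column of $A$, $z^{(i)}$ is the $i$th entry of a vector $z$, $e_j$ is the $j$th standard basis vector of $\mathbb{R}^n$, and $A^\dagger$ is the Moore–Penrose pseudoinverse. For a positive definite matrix $G$, $\|x\|_G=\sqrt{x^TGx}$. Put $s_k=A^T(b-Ax_k)$. Linear convergence of $x_k$ to $x_\star$ means that there are constants $C\ge 0$ and $q\in[0,1)$ with $\|x_\star-x_k\|_{A^TA}\le Cq^k$ for all $k$. Hoffman-like constant: $$\sigma(A^T,\infty)=\inf\left\{\frac{\|A^Tz\|_\infty}{\|z\|} : z\in\operatorname{range}(A),\ z\ne 0\right\}.$$ GDSCD method (for $A$ with unit-norm columns). Given $x_0$: Step 0. Choose $j_{0_1}\in\arg\max_{1\le j\le n}|s_0^{(j)}|$ and set $x_1=x_0+s_0^{(j_{0_1})}e_{j_{0_1}}$. Step $k$, for $k=1,2,\dots$. Choose $j_{k_1}\in\arg\max_{1\le j\le n}|s_k^{(j)}|$, and let $j_{k_2}=j_{(k-1)_1}$ be the maximizing index of $|s_{k-1}^{(j)}|$ that was selected as first index at the previous step. Set $$\widetilde\mu_k=\langle A_{(j_{k_1})},A_{(j_{k_2})}\rangle,\qquad \widetilde y_k=x_k+s_k^{(j_{k_1})}e_{j_{k_1}},$$ $$\widetilde v_k=\frac{A_{(j_{k_2})}-\widetilde\mu_kA_{(j_{k_1})}}{\sqrt{1-\widetilde\mu_k^2}},\qquad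 \widetilde\beta_k=\frac{(A_{(j_{k_2})}-\widetilde\mu_kA_{(j_{k_1})})^Tb}{\sqrt{1-\widetilde\mu_k^2}},\qquad w_k=\frac{e_{j_{k_2}}-\widetilde\mu_ke_{j_{k_1}}}{\sqrt{1-\widetilde\mu_k^2}},$$ $$x_{k+1}=\widetilde y_k+\left(\widetilde\beta_k-\widetilde v_k^TA\widetilde y_k\right)w_k.$$ *)

(* Defs.v *)
From mathcomp Require Import all_boot all_order all_algebra.
From mathcomp Require Import boolp classical_sets reals normedtype.

Set Implicit Arguments.
Unset Strict Implicit.
Unset Printing Implicit Defensive.

Import Order.TTheory GRing.Theory Num.Theory.
Local Open Scope ring_scope.
Local Open Scope classical_set_scope.

Definition inner (R : realType) (p : nat) (u v : 'cV[R]_p) : R :=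
  (u^T *m v) 0 0.

Definition norm2 (R : realType) (p : nat) (u : 'cV[R]_p) : R :=
  Num.sqrt (inner u u).

Definition normG (R : realType) (p : nat) (G : 'M[R]_p) (u : 'cV[R]_p) : R :=
  Num.sqrt ((u^T *m G *m u) 0 0).

Definition basis_vec (R : realType) (n : nat) (j : 'I_n) : 'cV[R]_n :=
  delta_mx j 0.

(** The four Penrose equations; they have at most one solution [X], and over
    the reals always exactly one. *)
Definition is_mp_pinv (R : realType) (m n : nat) (A : 'M[R]_(m, n))
    (X : 'M[R]_(n, m)) : Prop :=
  [/\ A *m X *m A = A, X *m A *m X = X,
      (A *m X)^T = A *m X & (X *m A)^T = X *m A].

(** [pinvmx] of [mxalgebra] is an arbitrary partial inverse, not this one. *)
Definition mp_pinv (R : realType) (m n : nat) (A : 'M[R]_(m, n)) :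
    'M[R]_(n, m) :=
  xget 0 [set X | is_mp_pinv A X].

Definition is_unique_lsq_minimizer (R : realType) (m n : nat)
    (A : 'M[R]_(m, n)) (b : 'cV[R]_m) (xs : 'cV[R]_n) : Prop :=
  forall y : 'cV[R]_n,
    (forall x : 'cV[R]_n,
       norm2 (b - A *m y) ^+ 2 <= norm2 (b - A *m x) ^+ 2) <-> y = xs.

(** [mx_norm] is the maximum of the absolute values of the entries. *)
Definition hoffman_inf (R : realType) (m n : nat) (A : 'M[R]_(m, n)) : R :=
  inf [set mx_norm (A^T *m z) / norm2 z |
        z in [set z : 'cV[R]_m | (exists x : 'cV[R]_n, z = A *m x) /\ z != 0]].

Definition linearly_converges (R : realType) (m n : nat) (A : 'M[R]_(m, n))
    (x : nat -> 'cV[R]_n) (xs : 'cV[R]_n) : Prop :=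
  exists C q : R, [/\ 0 <= C, 0 <= q < 1 &
    forall k : nat, normG (A^T *m A) (xs - x k) <= C * q ^+ k].

Definition lsq_grad (R : realType) (m n : nat) (A : 'M[R]_(m, n))
    (b : 'cV[R]_m) (x : 'cV[R]_n) : 'cV[R]_n :=
  A^T *m (b - A *m x).

Definition in_argmax_abs (R : realType) (n : nat) (s : 'cV[R]_n) (j : 'I_n) :
    Prop :=
  forall i : 'I_n, `|s i 0| <= `|s j 0|.

Definition gdscd_mu (R : realType) (m n : nat) (A : 'M[R]_(m, n))
    (j1 j2 : 'I_n) : R :=
  inner (col j1 A) (col j2 A).

Definition gdscd_first (R : realType) (m n : nat) (A : 'M[R]_(m, n))
    (b : 'cV[R]_m) (x : 'cV[R]_n) (j1 : 'I_n) : 'cV[R]_n :=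
  x + lsq_grad A b x j1 0 *: basis_vec R j1.

(** When the columns of [A] are independent unit vectors, [1 - mu ^+ 2] vanishes
    only if [j1 = j2]; then all three numerators below are zero, so the result
    is [y] whatever value is given to division by zero.  From the second step
    of the method on, [j1 = j2] can be selected only if the current iterate is
    already the minimizer. *)
Definition gdscd_step (R : realType) (m n : nat) (A : 'M[R]_(m, n))
    (b : 'cV[R]_m) (x : 'cV[R]_n) (j1 j2 : 'I_n) : 'cV[R]_n :=
  let mu := gdscd_mu A j1 j2 in
  let d := Num.sqrt (1 - mu ^+ 2) in
  let y := gdscd_first A b x j1 in
  let v := d^-1 *: (col j2 A - mu *: col j1 A) in
  let beta := inner (col j2 A - mu *: col j1 A) b / d in
  let w := d^-1 *: (basis_vec R j2 - mu *: basis_vec R j1) in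
  y + (beta - inner v (A *m y)) *: w.

(** [x] and [j] are the iterates and the first selected indices of one run from
    [x0]; ties in the argmax are broken arbitrarily.  The second index at step
    [k >= 1] is [j k.-1]. *)
Definition is_gdscd_run (R : realType) (m n : nat) (A : 'M[R]_(m, n))
    (b : 'cV[R]_m) (x0 : 'cV[R]_n) (x : nat -> 'cV[R]_n) (j : nat -> 'I_n) :
    Prop :=
  [/\ x 0%N = x0,
      forall k : nat, in_argmax_abs (lsq_grad A b (x k)) (j k),
      x 1%N = gdscd_first A b (x 0%N) (j 0%N) &
      forall k : nat, (0 < k)%N ->
        x k.+1 = gdscd_step A b (x k) (j k) (j k.-1)].

(* Main.v *)
Require Import Defs.
From mathcomp Require Import all_boot all_order all_algebra.
From mathcomp Require Import boolp classical_sets reals normedtype.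
From mathcomp Require Import ring.
Import Order.TTheory GRing.Theory Num.Theory.
Local Open Scope ring_scope.

(** The [A^T A]-norm of the error [xs - x] is the Euclidean norm of
    [r = A (xs - x)], and by the normal equations [A^T A xs = A^T b] the
    gradient entries [s^(j)] are the inner products [<A_(j), r>].  In terms of
    [r], the first half of a step is the orthogonal projection off the unit
    column [a1] of largest [|<a1, r>|]; it lowers [|r|^2] by [<a1, r>^2], which
    is at least [sigma^2 |r|^2] because [r] lies in the range of [A]
    ([inner_argmax_ge]).  This is the bound for the first step.

    The second half projects off [u = (a2 - mu a1) / sqrt (1 - mu^2)], a unit
    vector orthogonal to [a1].  The column [a2] was the first column of the
    previous step, whose two projections both leave the residual orthogonal to
    it; hence [<a2, r> = 0], so [<u, r> = - mu <a1, r> / sqrt (1 - mu^2)], and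
    the total decrease is
    [<a1, r>^2 (1 + mu^2 / (1 - mu^2)) = <a1, r>^2 / (1 - mu^2)]
    ([double_projection_sqnorm]).  The orthogonality is [run_orthogonal].

    If [1 - mu^2 <= 0], the conventions for square root and inverse make [u]
    zero and the claimed factor at least [1], so the first projection suffices
    ([double_projection_sqnorm_le]).

    Every step therefore multiplies [|r|^2] by at most [1 - sigma^2].  Linear
    convergence needs in addition [sigma > 0] ([hoffman_inf_gt0]): on the range
    of [A] the matrix [A (A^T A)^-1] recovers [z] from [A^T z], so [|z|] is
    bounded by a constant times the maximum norm of [A^T z]. *)

(** * Inner products *)

Lemma innerE {R : realType} {p : nat} (u v : 'cV[R]_p) :
  inner u v = \sum_i u i 0 * v i 0.
Proof. by rewrite /inner mxE; apply: eq_bigr => i _; rewrite mxE. Qed.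

Lemma innerC {R : realType} {p : nat} (u v : 'cV[R]_p) : inner u v = inner v u.
Proof. by rewrite !innerE; apply: eq_bigr => i _; rewrite mulrC. Qed.

Lemma innerDr {R : realType} {p : nat} (u v w : 'cV[R]_p) :
  inner u (v + w) = inner u v + inner u w.
Proof. by rewrite /inner mulmxDr mxE. Qed.

Lemma innerNr {R : realType} {p : nat} (u v : 'cV[R]_p) :
  inner u (- v) = - inner u v.
Proof. by rewrite /inner mulmxN mxE. Qed.

Lemma innerZr {R : realType} {p : nat} (c : R) (u v : 'cV[R]_p) :
  inner u (c *: v) = c * inner u v.
Proof. by rewrite /inner -scalemxAr mxE. Qed.

Lemma innerDl {R : realType} {p : nat} (u v w : 'cV[R]_p) :
  inner (u + v) w = inner u w + inner v w.
Proof. by rewrite !(@innerC _ _ _ w) innerDr. Qed.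

Lemma innerNl {R : realType} {p : nat} (u v : 'cV[R]_p) :
  inner (- u) v = - inner u v.
Proof. by rewrite !(@innerC _ _ _ v) innerNr. Qed.

Lemma innerZl {R : realType} {p : nat} (c : R) (u v : 'cV[R]_p) :
  inner (c *: u) v = c * inner u v.
Proof. by rewrite !(@innerC _ _ _ v) innerZr. Qed.

Definition inner_bilin {R : realType} {p : nat} :=
  (@innerDl R p, @innerDr R p, @innerNl R p, @innerNr R p,
   @innerZl R p, @innerZr R p).

Lemma inner_mulmxl {R : realType} {m n : nat} (A : 'M[R]_(m, n))
    (u : 'cV_n) (v : 'cV_m) :
  inner (A *m u) v = inner u (A^T *m v).
Proof. by rewrite /inner trmx_mul mulmxA. Qed.

Lemma inner_ge0 {R : realType} {p : nat} (u : 'cV[R]_p) : 0 <= inner u u.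
Proof. by rewrite innerE; apply: sumr_ge0 => i _; rewrite -expr2 sqr_ge0. Qed.

Lemma inner_eq0 {R : realType} {p : nat} (u : 'cV[R]_p) :
  (inner u u == 0) = (u == 0).
Proof.
apply/eqP/eqP => [|->]; last by rewrite /inner mulmx0 mxE.
rewrite innerE => /eqP; rewrite psumr_eq0 => [/allP u0|i _]; last first.
  by rewrite -expr2 sqr_ge0.
apply/colP => i; rewrite mxE; apply/eqP.
by have := u0 i (mem_index_enum i); rewrite /= mulf_eq0 orbb.
Qed.

Lemma norm2_sqr {R : realType} {p : nat} (u : 'cV[R]_p) :
  norm2 u ^+ 2 = inner u u.
Proof. by rewrite sqr_sqrtr // inner_ge0. Qed.

Lemma norm2_gt0 {R : realType} {p : nat} (u : 'cV[R]_p) :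
  (0 < norm2 u) = (u != 0).
Proof. by rewrite sqrtr_gt0 lt_def inner_ge0 andbT inner_eq0. Qed.

Lemma normG_gram {R : realType} {m n : nat} (A : 'M[R]_(m, n)) (e : 'cV_n) :
  normG (A^T *m A) e = norm2 (A *m e).
Proof. by rewrite /normG /norm2 /inner trmx_mul !mulmxA. Qed.

Lemma mulmx_trE {R : realType} {m n : nat} (A : 'M[R]_(m, n)) (u : 'cV_m)
    (i : 'I_n) :
  (A^T *m u) i 0 = inner (col i A) u.
Proof.
by rewrite innerE mxE; apply: eq_bigr => k _; rewrite !mxE.
Qed.

(** * Projections *)

Lemma projection_orthogonal {R : realType} {p : nat} (a r : 'cV[R]_p) :
  inner a a = 1 -> inner a (r - inner a r *: a) = 0.
Proof. by move=> a1; rewrite !inner_bilin a1 mulr1 subrr. Qed.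

Lemma projection_sqnorm {R : realType} {p : nat} (a r : 'cV[R]_p)
    (r' := r - inner a r *: a) :
  inner a a = 1 -> inner r' r' = inner r r - inner a r ^+ 2.
Proof. by move=> a1; rewrite !inner_bilin a1 (innerC r a); ring. Qed.

(** Gram-Schmidt on the current column [a1] and the previous one [a2], applied
    to the residual; when [mu ^+ 2 >= 1] the vector [u] is zero and only the
    projection off [a1] remains. *)
Definition double_projection {R : realType} {p : nat} (a1 a2 r : 'cV[R]_p) :=
  let mu := inner a1 a2 in
  let u := (Num.sqrt (1 - mu ^+ 2))^-1 *: (a2 - mu *: a1) in
  let r' := r - inner a1 r *: a1 in
  r' - inner u r' *: u.

Lemma double_projection_orthogonal {R : realType} {p : nat}
    (a1 a2 r : 'cV[R]_p) :
  inner a1 a1 = 1 -> inner a1 (double_projection a1 a2 r) = 0.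
Proof. by move=> h1; rewrite !inner_bilin h1; ring. Qed.

(** The decreases [<a1, r>^2] and [<u, r>^2] add up because [u] is a unit vector
    orthogonal to [a1]; as [<a2, r> = 0], the second one is
    [mu^2 / (1 - mu^2)] times the first. *)
Lemma double_projection_sqnorm {R : realType} {p : nat} (a1 a2 r : 'cV[R]_p)
    (r' := double_projection a1 a2 r) :
  inner a1 a1 = 1 -> inner a2 a2 = 1 -> inner a2 r = 0 ->
  0 < 1 - inner a1 a2 ^+ 2 ->
  inner r' r' = inner r r - (1 - inner a1 a2 ^+ 2)^-1 * inner a1 r ^+ 2.
Proof.
rewrite /r' /double_projection; set mu := inner a1 a2.
move=> h1 h2 h2r mu1; set d := Num.sqrt _.
have dd : d ^+ 2 = 1 - mu ^+ 2 by rewrite sqr_sqrtr // ltW.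
have d0 : d != 0 by rewrite gt_eqF // sqrtr_gt0.
rewrite projection_sqnorm; last first.
  rewrite !inner_bilin h1 h2 (innerC a2 a1) -/mu.
  transitivity ((d ^+ 2)^-1 * (1 - mu ^+ 2)); first by field.
  by rewrite dd mulVf // gt_eqF.
rewrite projection_sqnorm // !inner_bilin h1 h2r (innerC a2 a1) -/mu -dd.
(* What [field] cannot see is the relation [mu^2 = 1 - d^2]; it is substituted
   once the decrease is factored, where only [mu^2] occurs. *)
transitivity (inner r r - inner a1 r ^+ 2 * (1 + mu ^+ 2 / d ^+ 2)).
  by field.
have -> : mu ^+ 2 = 1 - d ^+ 2 by rewrite dd; ring.
by field.
Qed.

(** The second projection can only help, and it is void when [mu^2 >= 1], where
    the square root and hence [u] vanish. *)
Lemma double_projection_sqnorm_le {R : realType} {p : nat}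
    (a1 a2 r : 'cV[R]_p) (r' := double_projection a1 a2 r) :
  inner a1 a1 = 1 -> inner a2 a2 = 1 -> inner a2 r = 0 ->
  inner r' r' <= inner r r - inner a1 r ^+ 2.
Proof.
move=> h1 h2 h2r; have [mu1|mu1] := ltP 0 (1 - inner a1 a2 ^+ 2).
  rewrite double_projection_sqnorm // lerB // ler_peMl ?sqr_ge0 //.
  by rewrite invf_ge1 // gerDl oppr_le0 sqr_ge0.
rewrite /r' /double_projection ler0_sqrtr // invr0 scale0r scaler0 subr0.
by rewrite projection_sqnorm.
Qed.

(** * Least squares *)

Lemma gram_unit {R : realType} {m n : nat} (A : 'M[R]_(m, n)) :
  \rank A = n -> A^T *m A \in unitmx.
Proof.
move=> rkA; rewrite -row_free_unit; apply: inj_row_free => v vG0.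
have AT_free : row_free A^T by rewrite /row_free mxrank_tr rkA.
have : A *m v^T = 0.
  apply/eqP; rewrite -inner_eq0 inner_mulmxl /inner trmxK !mulmxA.
  by rewrite -(mulmxA v) vG0 mul0mx mxE.
move/(congr1 trmx); rewrite trmx_mul trmxK trmx0 -(mul0mx _ A^T).
exact: row_free_inj.
Qed.

(** With full column rank, [(A^T A)^-1 A^T] satisfies the Penrose equations, so
    [mp_pinv] satisfies them too; these alone already give
    [A^T A X = A^T (A X)^T = (A X A)^T = A^T]. *)
Lemma mp_pinv_normal_equations {R : realType} {m n : nat} (A : 'M[R]_(m, n))
    (b : 'cV_m) :
  \rank A = n -> A^T *m (A *m (mp_pinv A *m b)) = A^T *m b.
Proof.
move=> /gram_unit unitG.
have GA1 : invmx (A^T *m A) *m A^T *m A = 1%:M by rewrite -mulmxA mulVmx.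
have [AXA _ AX_sym _] : is_mp_pinv A (mp_pinv A).
  apply: (@xgetPex _ 0 (is_mp_pinv A)); exists (invmx (A^T *m A) *m A^T).
  split; rewrite ?GA1 ?mul1mx ?trmx1 //.
    by rewrite -mulmxA GA1 mulmx1.
  by rewrite !trmx_mul trmx_inv trmx_mul !trmxK mulmxA.
have ATAX : A^T *m (A *m mp_pinv A) = A^T by rewrite -AX_sym -trmx_mul AXA.
by rewrite (mulmxA A) mulmxA ATAX.
Qed.

Lemma lsq_unique_minimizer {R : realType} {m n : nat} (A : 'M[R]_(m, n))
    (b : 'cV_m) (xs : 'cV_n) :
  \rank A = n -> A^T *m (A *m xs) = A^T *m b ->
  is_unique_lsq_minimizer A b xs.
Proof.
move=> rkA normal.
have pythagoras x : norm2 (b - A *m x) ^+ 2 =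
    norm2 (b - A *m xs) ^+ 2 + norm2 (A *m (xs - x)) ^+ 2.
  have -> : b - A *m x = (b - A *m xs) + A *m (xs - x).
    by rewrite mulmxBr addrA subrK.
  have orth : inner (A *m (xs - x)) (b - A *m xs) = 0.
    by rewrite inner_mulmxl mulmxBr normal subrr /inner mulmx0 mxE.
  rewrite !norm2_sqr; move: (b - _) (A *m (xs - x)) orth => u v vu0.
  by rewrite innerDl !innerDr (innerC u v) vu0 addr0 add0r.
move=> y; split => [miny|-> x]; last by rewrite (pythagoras x) lerDl sqr_ge0.
have := miny xs; rewrite pythagoras gerDl norm2_sqr => le0.
have /eqP : A *m (xs - y) == 0 by rewrite -inner_eq0 eq_le le0 inner_ge0.
move/(congr1 (mulmx A^T)); rewrite mulmxA mulmx0.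
move/(congr1 (mulmx (invmx (A^T *m A)))).
by rewrite mulKmx ?gram_unit // mulmx0 => /eqP; rewrite subr_eq0 => /eqP.
Qed.

(** * The Hoffman-like constant *)

Lemma mx_norm_col_ge {R : realType} {p : nat} (s : 'cV[R]_p) (i : 'I_p) :
  `|s i 0| <= mx_norm s.
Proof.
by rewrite mx_normrE (le_bigmax 0 (fun ij => `|s ij.1 ij.2|) (i, 0)).
Qed.

Lemma mx_norm_ge0 {R : realType} {m n : nat} (s : 'M[R]_(m, n)) :
  0 <= mx_norm s.
Proof. exact: (normr_ge0 s). Qed.

Lemma mx_norm_argmax {R : realType} {p : nat} (s : 'cV[R]_p) (j : 'I_p) :
  in_argmax_abs s j -> mx_norm s <= `|s j 0|.
Proof.
by move=> sj; rewrite mx_normrE bigmax_le // => -[i k] _; rewrite [k]ord1 sj.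
Qed.

Lemma norm2_mulmx_bounded {R : realType} {m n : nat} (M : 'M[R]_(m, n)) :
  exists2 C, 0 < C & forall s : 'cV_n, norm2 (M *m s) <= C * mx_norm s.
Proof.
pose K := \sum_i (\sum_j `|M i j|) ^+ 2.
have K0 : 0 <= K by apply: sumr_ge0 => i _; rewrite sqr_ge0.
(* [1 + K] rather than [K], so that the constant is positive for [M = 0]. *)
exists (Num.sqrt (1 + K)) => [|s]; first by rewrite sqrtr_gt0 ltr_wpDr.
have N0 := mx_norm_ge0 s.
rewrite -(ler_pXn2r (ltn0Sn 1)) ?nnegrE ?mulr_ge0 ?sqrtr_ge0 //.
rewrite norm2_sqr exprMn sqr_sqrtr ?addr_ge0 // innerE.
apply: (@le_trans _ _ (K * mx_norm s ^+ 2)); last first.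
  by rewrite ler_wpM2r ?sqr_ge0 // lerDr.
rewrite mulr_suml; apply: ler_sum => i _.
rewrite -exprMn -expr2 -(real_normK (num_real _)).
rewrite ler_pXn2r ?nnegrE //; last by rewrite mulr_ge0 // sumr_ge0.
rewrite mxE mulr_suml (le_trans (ler_norm_sum _ _ _)) //.
by apply: ler_sum => k _; rewrite normrM ler_wpM2l // mx_norm_col_ge.
Qed.

Lemma hoffman_inf_le {R : realType} {m n : nat} (A : 'M[R]_(m, n)) (e : 'cV_n) :
  hoffman_inf A * norm2 (A *m e) <= mx_norm (A^T *m (A *m e)).
Proof.
have [->|Ae0] := eqVneq (A *m e) 0.
  rewrite /norm2 (eqP (_ : inner _ _ == 0)) ?inner_eq0 //.
  by rewrite sqrtr0 mulr0 mx_norm_ge0.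
rewrite -ler_pdivlMr ?norm2_gt0 //; apply: ge_inf.
  by exists 0 => _ [z _ <-]; rewrite divr_ge0 ?mx_norm_ge0 ?sqrtr_ge0.
by exists (A *m e) => //; split; first by exists e.
Qed.

Lemma hoffman_inf_ge0 {R : realType} {m n : nat} (A : 'M[R]_(m, n)) :
  0 <= hoffman_inf A.
Proof.
rewrite /hoffman_inf; set S := (X in inf X).
have [->|/set0P S0] := eqVneq S set0; first by rewrite inf0.
apply: lb_le_inf => // _ [z _ <-].
by rewrite divr_ge0 ?mx_norm_ge0 ?sqrtr_ge0.
Qed.

(** The nonzero [A e] excludes the empty set, whose infimum is [0] by
    convention; the lower bound comes from
    [z = A (A^T A)^-1 (A^T z)] on the range of [A]. *)
Lemma hoffman_inf_gt0 {R : realType} {m n : nat} (A : 'M[R]_(m, n))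
    (e : 'cV_n) :
  \rank A = n -> A *m e != 0 -> 0 < hoffman_inf A.
Proof.
move=> rkA Ae0.
have [C C0 MC] := norm2_mulmx_bounded (A *m invmx (A^T *m A)).
apply: (@lt_le_trans _ _ C^-1); first by rewrite invr_gt0.
apply: lb_le_inf.
  exists (mx_norm (A^T *m (A *m e)) / norm2 (A *m e)).
  by exists (A *m e) => //; split; first by exists e.
move=> _ [z [[x zx] z0] <-].
rewrite ler_pdivlMr ?norm2_gt0 // ler_pdivrMl //.
have {1}-> : z = A *m invmx (A^T *m A) *m (A^T *m z); last exact: MC.
by rewrite zx -mulmxA (mulmxA A^T) mulKmx // gram_unit.
Qed.

(** The entry of [A^T r] at a maximizing index is, up to sign, the maximum norm
    of [A^T r], which the Hoffman-like constant compares with [|r|] for [r] in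
    the range of [A] only; hence residuals of the form [A e]. *)
Lemma inner_argmax_ge {R : realType} {m n : nat} (A : 'M[R]_(m, n)) (e : 'cV_n)
    (j : 'I_n) (r := A *m e) :
  in_argmax_abs (A^T *m r) j ->
  hoffman_inf A ^+ 2 * inner r r <= inner (col j A) r ^+ 2.
Proof.
move=> /mx_norm_argmax le_j.
rewrite -norm2_sqr -exprMn -(real_normK (num_real (inner _ _))).
rewrite ler_pXn2r ?nnegrE ?mulr_ge0 ?hoffman_inf_ge0 ?sqrtr_ge0 //.
by rewrite -mulmx_trE (le_trans (hoffman_inf_le _ _)).
Qed.

(** * Residuals along a run *)

Lemma mulmx_basis_vec {R : realType} {m n : nat} (A : 'M[R]_(m, n)) (i : 'I_n) :
  A *m basis_vec R i = col i A.
Proof. by rewrite colE. Qed.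

Lemma lsq_gradE {R : realType} {m n : nat} (A : 'M[R]_(m, n)) (b : 'cV_m)
    (xs x : 'cV_n) :
  A^T *m (A *m xs) = A^T *m b -> lsq_grad A b x = A^T *m (A *m (xs - x)).
Proof. by move=> normal; rewrite /lsq_grad !mulmxBr normal. Qed.

Lemma residual_first {R : realType} {m n : nat} (A : 'M[R]_(m, n)) (b : 'cV_m)
    (xs x : 'cV_n) (i : 'I_n) (r := A *m (xs - x)) :
  A^T *m (A *m xs) = A^T *m b ->
  A *m (xs - gdscd_first A b x i) = r - inner (col i A) r *: col i A.
Proof.
move=> normal; rewrite /gdscd_first (lsq_gradE _ _ _ _ normal) mulmx_trE -/r.
by rewrite opprD addrA mulmxBr -scalemxAr mulmx_basis_vec.
Qed.

(** The method computes the second step length from [b] and not from the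
    residual; the two agree because [b] and [A xs] have the same inner products
    with the columns of [A]. *)
Lemma residual_step {R : realType} {m n : nat} (A : 'M[R]_(m, n)) (b : 'cV_m)
    (xs x : 'cV_n) (i k : 'I_n) (r := A *m (xs - x)) :
  A^T *m (A *m xs) = A^T *m b ->
  A *m (xs - gdscd_step A b x i k) = double_projection (col i A) (col k A) r.
Proof.
move=> normal; rewrite /gdscd_step /double_projection /gdscd_mu.
rewrite -(residual_first _ _ _ _ _ normal).
set y := gdscd_first _ _ _ _; set mu := inner (col i A) (col k A).
set d := Num.sqrt _.
rewrite opprD addrA mulmxBr -!scalemxAr (mulmxBr A (basis_vec R k))
  -scalemxAr !mulmx_basis_vec.
congr (_ - _ *: _).
have colb l : inner (col l A) b = inner (col l A) (A *m xs).
  by rewrite -!mulmx_trE normal.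
by rewrite mulmxBr !inner_bilin !colb; ring.
Qed.

(** This is what makes reusing the previous column effective: its gradient entry
    has just been cancelled.  No induction is involved: both kinds of step
    leave a residual orthogonal to their own first column. *)
Lemma run_orthogonal {R : realType} {m n : nat} (A : 'M[R]_(m, n)) (b : 'cV_m)
    (xs x0 : 'cV_n) (x : nat -> 'cV_n) (j : nat -> 'I_n) (k : nat) :
  (forall i, norm2 (col i A) = 1) -> A^T *m (A *m xs) = A^T *m b ->
  is_gdscd_run A b x0 x j ->
  inner (col (j k) A) (A *m (xs - x k.+1)) = 0.
Proof.
move=> hunit normal [_ _ x1 xS].
have unit i : inner (col i A) (col i A) = 1 by rewrite -norm2_sqr hunit expr1n.
case: k => [|k]; first by rewrite x1 residual_first // projection_orthogonal.
by rewrite xS // residual_step // double_projection_orthogonal.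
Qed.

Theorem theorem1 (R : realType) (m n : nat) (A : 'M[R]_(m, n)) (b : 'cV[R]_m)
    (xs x0 : 'cV[R]_n) (x : nat -> 'cV[R]_n) (j : nat -> 'I_n)
    (hmn : (n < m)%N)
    (hrank : \rank A = n)
    (hunit : forall i : 'I_n, norm2 (col i A) = 1)
    (hxs : xs = mp_pinv A *m b)
    (hrun : is_gdscd_run A b x0 x j) :
  [/\ is_unique_lsq_minimizer A b xs,
      linearly_converges A x xs,
      normG (A^T *m A) (xs - x 1%N) ^+ 2
        <= (1 - hoffman_inf A ^+ 2) * normG (A^T *m A) (xs - x 0%N) ^+ 2 &
      forall k : nat, (0 < k)%N ->
        normG (A^T *m A) (xs - x k.+1) ^+ 2
          <= (1 - 1 / (1 - gdscd_mu A (j k) (j k.-1) ^+ 2)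
                    * hoffman_inf A ^+ 2)
             * normG (A^T *m A) (xs - x k) ^+ 2].
Proof.
have normal : A^T *m (A *m xs) = A^T *m b.
  by rewrite hxs mp_pinv_normal_equations.
have unit i : inner (col i A) (col i A) = 1 by rewrite -norm2_sqr hunit expr1n.
have [_ greedy x1 xS] := hrun.
set sigma := hoffman_inf A.
pose r k := A *m (xs - x k).
have normGr k : normG (A^T *m A) (xs - x k) ^+ 2 = inner (r k) (r k).
  by rewrite normG_gram norm2_sqr.
have greedy_r k :
    sigma ^+ 2 * inner (r k) (r k) <= inner (col (j k) A) (r k) ^+ 2.
  by apply: inner_argmax_ge; rewrite -(lsq_gradE _ _ _ _ normal).
have first_bound : inner (r 1%N) (r 1%N)
    <= (1 - sigma ^+ 2) * inner (r 0%N) (r 0%N).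
  rewrite {1 2}/r x1 residual_first // projection_sqnorm //.
  by rewrite mulrBl mul1r lerB.
have prev_orth k : inner (col (j k) A) (r k.+1) = 0.
  exact: run_orthogonal hrun.
have step_r k :
    r k.+2 = double_projection (col (j k.+1) A) (col (j k) A) (r k.+1).
  by rewrite /r xS // residual_step.
have contraction k : inner (r k.+1) (r k.+1)
    <= (1 - sigma ^+ 2) * inner (r k) (r k).
  case: k => // k; rewrite step_r.
  apply: (le_trans (double_projection_sqnorm_le _ _ _ _ _ _)) => //.
  by rewrite mulrBl mul1r lerB.
split.
- exact: lsq_unique_minimizer.
- have sigma0 : 0 < sigma.
    apply: (@hoffman_inf_gt0 _ _ _ A (basis_vec R (j 0%N))) => //.
    by rewrite mulmx_basis_vec -inner_eq0 unit oner_neq0.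
  exists (norm2 (r 0%N)), (Num.sqrt (1 - sigma ^+ 2)); split.
  + exact: sqrtr_ge0.
  + rewrite sqrtr_ge0 -[ltRHS]sqrtr1 ltr_sqrt //.
    by rewrite gtrDl oppr_lt0 exprn_gt0.
  + elim=> [|k IHk]; rewrite normG_gram; first by rewrite expr0 mulr1.
    rewrite exprSr mulrA (le_trans (ler_wsqrtr (contraction k))) //.
    rewrite mulrC sqrtrM ?inner_ge0 // ler_wpM2r ?sqrtr_ge0 //.
    by rewrite -/(norm2 _) -normG_gram.
- by rewrite !normGr.
- case=> // k _; rewrite !normGr mul1r /= /gdscd_mu.
  set mu := inner (col _ A) (col _ A).
  have [mu1|mu1] := ltP 0 (1 - mu ^+ 2).
    by rewrite step_r double_projection_sqnorm // mulrBl mul1r -mulrA lerB //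
       ler_wpM2l // invr_ge0 ltW.
  (* Dividing by [1 - mu^2 <= 0] makes the factor at least [1]. *)
  apply: (@le_trans _ _ (inner (r k.+1) (r k.+1))).
    apply: le_trans (contraction k.+1) _.
    by rewrite ler_piMl ?inner_ge0 // gerDl oppr_le0 sqr_ge0.
  rewrite ler_peMl ?inner_ge0 // lerDl oppr_ge0 mulr_le0_ge0 ?sqr_ge0 //.
  by rewrite invr_le0.
Qed.
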